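(* A path $c:I\rightarrow X$ in a metric space $X$ that is $1$-dimensional in some sense is normal if and only if $c$ is weakly normal.
   Context: A path is a continuous map from a compact interval. A path $c:[a,b]\to X$ is normal if there is no nontrivial subsegment $J=[u,v]\subset[a,b]$ such that $c(u)=c(v)$ and $c|_J$ is homotopic (in $X$) to a constant relative to $\{u,v\}$. It is weakly normal if there is no nontrivial subsegment $J=[u,v]\subset[a,b]$ such that $c(u)=c(v)$ and $c|_J$ is homotopic in $c(J)$ to a constant relative to $\{u,v\}$. ''$X$ is $1$-dimensional in some sense'' means that at least one of the following dimensions of $X$ equals $1$: the small inductive dimension $\operatorname{ind}(X)$, the large inductive dimension $\operatorname{Ind}(X)$, the covering dimension $\dim(X)$, or the uniform dimension $u\dim(X)$. The uniform dimension is defined like the covering dimension except that the open covers involved are required to be uniform, where an open cover of a metric space is uniform if it is refined by the cover by all $\varepsilon$-balls for some $\varepsilon>0$. *)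

(* Defs.v *)
From HB Require Import structures.
From mathcomp Require Import all_boot all_order all_algebra.
From mathcomp Require Import all_classical all_reals all_analysis.

Set Implicit Arguments.
Unset Strict Implicit.
Unset Printing Implicit Defensive.

Import Order.TTheory GRing.Theory Num.Theory.
Import numFieldNormedType.Exports.

Local Open Scope classical_set_scope.
Local Open Scope ring_scope.
Local Open Scope card_scope.

(* All dimensions below are introduced through a predicate [D n] meaning
   "dimension < n", i.e. "dimension <= n - 1"; this shift by one lets n : nat
   account for the dimension -1 of the empty space. *)
Definition has_dim (D : nat -> Prop) (n : nat) : Prop :=
  D n.+1 /\ forall k, (k <= n)%N -> ~ D k.

Definition frontier (T : topologicalType) (A : set T) : set T :=
  closure A `&` closure (~` A).

(* In the recursive calls, [set_type (frontier V)] carries the subspace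
   topology. *)
Fixpoint ind_lt (n : nat) (T : topologicalType) : Prop :=
  match n with
  | 0 => ~ inhabited T
  | m.+1 => forall (x : T) (U : set T), open U -> U x ->
      exists V : set T,
        [/\ open V, V x, V `<=` U & ind_lt m (set_type (frontier V))]
  end.

Fixpoint Ind_lt (n : nat) (T : topologicalType) : Prop :=
  match n with
  | 0 => ~ inhabited T
  | m.+1 => forall F U : set T, closed F -> open U -> F `<=` U ->
      exists V : set T,
        [/\ open V, F `<=` V, V `<=` U & Ind_lt m (set_type (frontier V))]
  end.

Definition open_cover (T : topologicalType) (C : set (set T)) : Prop :=
  C `<=` open /\ \bigcup_(A in C) A = setT.

Definition refines (T : Type) (C' C : set (set T)) : Prop :=
  forall B, C' B -> exists2 A, C A & B `<=` A.

Definition multiplicity_le (T : Type) (n : nat) (C : set (set T)) : Prop :=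
  forall x : T, [set A | C A /\ A x] #<= `I_n.

Definition cov_lt (n : nat) (T : topologicalType) : Prop :=
  forall C : set (set T), open_cover C ->
    exists C' : set (set T),
      [/\ open_cover C', refines C' C & multiplicity_le n C'].

Definition uniform_cover (R : realType) (X : metricType R)
    (C : set (set X)) : Prop :=
  open_cover C /\
  exists2 e : R, 0 < e & refines (range (fun x : X => ball x e)) C.

Definition ucov_lt (R : realType) (n : nat) (X : metricType R) : Prop :=
  forall C : set (set X), uniform_cover C ->
    exists C' : set (set X),
      [/\ uniform_cover C', refines C' C & multiplicity_le n C'].

Definition one_dimensional (R : realType) (X : metricType R) : Prop :=
  [\/ has_dim (fun n => ind_lt n X) 1,
      has_dim (fun n => Ind_lt n X) 1,
      has_dim (fun n => cov_lt n X) 1 |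
      has_dim (fun n => ucov_lt n X) 1].

(* A path defined on [a, b] is represented by a function on R of which only the
   restriction to [a, b] matters. *)
Definition is_path (R : realType) (X : topologicalType) (a b : R)
    (c : R -> X) : Prop :=
  a <= b /\ {within `[a, b], continuous c}.

(* Homotopy in A, relative to {u, v}, between the restrictions of f and g to
   [u, v]. *)
Definition homotopic_rel_ends (R : realType) (X : topologicalType)
    (A : set X) (u v : R) (f g : R -> X) : Prop :=
  exists H : R * R -> X,
    [/\ {within `[u, v] `*` `[0, 1], continuous H},
        H @` (`[u, v] `*` `[0, 1]) `<=` A,
        (forall t, t \in `[u, v] -> H (t, 0) = f t /\ H (t, 1) = g t) &
        (forall s, s \in `[0, 1] -> H (u, s) = f u /\ H (v, s) = f v)].

Definition nullhomotopic_in (R : realType) (X : topologicalType)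
    (A : set X) (u v : R) (c : R -> X) : Prop :=
  exists x0 : X, homotopic_rel_ends A u v c (cst x0).

Definition normal_path (R : realType) (X : topologicalType) (a b : R)
    (c : R -> X) : Prop :=
  ~ exists u v : R,
      [/\ a <= u, u < v, v <= b, c u = c v & nullhomotopic_in setT u v c].

Definition weakly_normal_path (R : realType) (X : topologicalType) (a b : R)
    (c : R -> X) : Prop :=
  ~ exists u v : R,
      [/\ a <= u, u < v, v <= b, c u = c v &
          nullhomotopic_in (c @` `[u, v]) u v c].

(* Main.v *)
Require Import Defs.
From HB Require Import structures.
From mathcomp Require Import all_boot all_order all_algebra.
From mathcomp Require Import all_classical all_reals all_analysis.
From mathcomp Require Import zify lra ring.

(** If [H] is a null-homotopy of the loop [c] on [[u, v]] rel. end points, its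
    image [Y] is compact, and one-dimensionality lets us colour [Y] so that
    points of equal colour are close while three points that are very close to
    each other show at most two colours.  Colouring a fine grid of the square
    through [H] gives no trichromatic triangle, so the word of colours read
    along [c] reduces to a trivial one in the free groupoid of a graph.  The
    length of the reduced prefixes is a height function, and pairing two times
    of equal height with no lower time in between pairs points of [c] which are
    close.  Along an ultrafilter these pairings converge to a closed relation
    [L], such that [L x y] implies [c x = c y], and which behaves like the
    relation of a path to the points of a dendrite it runs around.  Truncating
    the loop at time [r] and then going back along [L] contracts it inside its
    own image. *)

Set Implicit Arguments.
Unset Strict Implicit.
Unset Printing Implicit Defensive.

Import Order.TTheory GRing.Theory Num.Theory.
Import numFieldNormedType.Exports.

Local Open Scope classical_set_scope.

(** * Reduction of walks in a graph *)

Section Reduction.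
Variable T : eqType.
Implicit Types (s : seq T) (w : nat -> T).

(* A stack represents a walk without backtracking, last vertex on top; pushing
   a vertex equal to the last but one cancels the last step. *)
Definition push s (a : T) : seq T :=
  if s is b :: s' then
    if a == b then s else if ohead s' == Some a then s' else a :: s
  else [:: a].

Fixpoint reduced s : bool :=
  if s is a :: s' then (ohead (behead s') != Some a) && reduced s' else true.

Lemma reduced_push s a : reduced s -> reduced (push s a).
Proof.
case: s => [|b s] //= /andP[bs rs].
case: ifPn => [|_]; first by rewrite /= bs rs.
by case: ifPn => [//|sa] /=; rewrite sa bs rs.
Qed.

Lemma ohead_push s a : ohead (push s a) = Some a.
Proof.
case: s => [|b s] //=; case: eqP => [->//|_].
by case: ifPn => // /eqP.
Qed.

(** Either one of the two steps is stationary, or [c] is [a] and the step to [b] is undone. If that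
    step was itself a cancellation, [reduced s] ensures that pushing [a] again restores [s]. *)
Lemma push_push s a b c : reduced s -> ohead s = Some a ->
  [|| a == b, b == c | a == c] -> push (push s b) c = push s c.
Proof.
case: s => [//|x s] rs [xa]; subst x.
case: (eqVneq a b) => [->|ab] /=; first by rewrite eqxx.
case: (eqVneq b c) => [<- _|bc] /=.
  have := ohead_push (a :: s) b; rewrite /= .
  case: (if b == a then _ else _) => [//|d t] [->] /=; by rewrite eqxx.
move=> /eqP ac; subst c; rewrite eqxx (negbTE bc).
case: s rs => [|d s] /= rs.
  by rewrite eq_sym (negbTE bc) eqxx.
case: ifPn => [/eqP[db]|_]; last first.
  by rewrite /= eq_sym (negbTE bc) eqxx.
subst d; rewrite /= (negbTE ab).
by case/andP: rs => /negbTE -> _.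
Qed.

Fixpoint walk w n : seq T :=
  if n is m.+1 then push (walk w m) (w m.+1) else [:: w 0%N].

Lemma reduced_walk w n : reduced (walk w n).
Proof. by elim: n => //= n IH; apply: reduced_push. Qed.

Lemma ohead_walk w n : ohead (walk w n) = Some (w n).
Proof. by case: n => //= n; apply: ohead_push. Qed.

(** Each cell is cut by the diagonal from [(q, p)] to [(q.+1, p.+1)], and [push_push] moves the walk
    across both triangles. Sweeping the rows ends at the constant row [M]. *)
Lemma walk_null_grid (w : nat -> nat -> T) N M a :
  (forall q, (q <= M)%N -> w q 0%N = a) ->
  (forall q, (q <= M)%N -> w q N = a) ->
  (forall p, (p <= N)%N -> w M p = a) ->
  (forall q p, (q < M)%N -> (p < N)%N ->
    [|| w q p == w q.+1 p, w q.+1 p == w q.+1 p.+1 | w q p == w q.+1 p.+1] &&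
    [|| w q p == w q p.+1, w q p.+1 == w q.+1 p.+1 | w q p == w q.+1 p.+1]) ->
  walk (w 0%N) N = [:: a].
Proof.
move=> left0 right0 top0 tri.
have rowS q p : (q < M)%N -> (p <= N)%N ->
    walk (w q.+1) p = push (walk (w q) p) (w q.+1 p).
  move=> qM; elim: p => [|p IH] pN /=.
    by rewrite !left0 ?(ltnW qM)//= eqxx.
  have /andP[t1 t2] := tri _ _ qM pN.
  rewrite IH 1?ltnW//.
  rewrite (push_push (reduced_walk _ _) (ohead_walk _ _) t1).
  by rewrite (push_push (reduced_walk _ _) (ohead_walk _ _) t2).
have row q : (q <= M)%N -> walk (w 0%N) N = walk (w q) N.
  elim: q => [//|q IH] qM; rewrite (IH (ltnW qM)) rowS// right0//.
  have := ohead_walk (w q) N; rewrite right0 1?ltnW//.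
  by case: (walk _ _) => //= b s [->]; rewrite eqxx.
rewrite (row M)//.
have : forall p, (p <= N)%N -> walk (w M) p = [:: a].
  elim=> [|p IH] pN /=; first by rewrite left0.
  by rewrite IH 1?ltnW//= top0// eqxx.
by apply.
Qed.

(** * Heights and matched times *)

Definition height w n := size (walk w n).

(** Reduced walks are the nodes of a tree; matched times are two visits to one node with only its
    descendants visited in between. *)
Definition matched w i j := (i <= j)%N /\ height w i = height w j /\
  forall k, (i <= k <= j)%N -> (height w i <= height w k)%N.

Lemma height_step w n :
  (height w n.+1 <= (height w n).+1)%N /\ (height w n <= (height w n.+1).+1)%N.
Proof.
rewrite /height /=; case: (walk w n) => //= b s.
by case: ifP => //= _; case: ifP => //= _; lia.
Qed.

(** A push removes at most the top, so the stack of time [i] stays at the bottom until the height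
    drops below its size. *)
Lemma walk_suffix w i j : (i <= j)%N ->
  (forall k, (i <= k <= j)%N -> (height w i <= height w k)%N) ->
  exists p, walk w j = p ++ walk w i.
Proof.
elim: j => [|j IH]; first by rewrite leqn0 => /eqP -> _; exists [::].
rewrite leq_eqVlt => /orP[/eqP <- _|ij ge]; first by exists [::].
have [|k ik|p wj] := IH; [lia|apply: ge; lia|].
have := ge j.+1; rewrite /height /= wj.
case: p wj => [|x p] wj /=.
  move=> /(_ ltac:(lia)).
  case: (walk w i) => [|b s] /=; first by exists [:: w j.+1].
  case: ifP => _; first by exists [::].
  case: ifP => [_ /=|_ _]; first by lia.
  by exists [:: w j.+1].
case: ifP => _ _; first by exists (x :: p).
case: ifP => _; first by exists p.
by exists [:: w j.+1, x & p].
Qed.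

Lemma matched_eq w i j : matched w i j -> w i = w j.
Proof.
case=> ij [hij hk]; have [p wp] := walk_suffix ij hk.
have p0 : p = [::].
  apply/size0nil; move: hij; rewrite /height wp size_cat; lia.
have := ohead_walk w j; rewrite wp p0 /= ohead_walk.
by case.
Qed.

Lemma matched_refl w i : matched w i i.
Proof. by split=> //; split=> // k /andP[ik ki]; have -> : k = i by lia. Qed.

(** Minimality gives [height w i <= height w i' <= height w j], whose ends are equal, so [i] and
    [i'] are themselves matched. *)
Lemma matched_crossing w i j i' j' : matched w i j -> matched w i' j' ->
  (i <= i')%N -> (i' <= j)%N -> (j <= j')%N -> w i = w i'.
Proof.
move=> [ij [hij hk]] [ij' [hij' hk']] ii' i'j jj'; apply: matched_eq.
have h1 := hk i' ltac:(lia); have h2 := hk' j ltac:(lia).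
split=> //; split; first by lia.
by move=> k ki; apply: hk; lia.
Qed.

(** Follows the branch of the tree from the node of [i] to that of [i'] and stops where [P] first
    becomes true. Every node of the branch is visited again between [j'] and [j], which supplies
    [l]. *)
Lemma matched_intermediate w (P : pred nat) i j i' j' :
  matched w i j -> matched w i' j' -> (i <= i')%N -> (j' <= j)%N ->
  ~~ P i -> P i' ->
  exists k k' l, [/\ ~~ P k, P k', w k = w k' \/ k' = k.+1, matched w k' l &
    (i <= k)%N /\ (k <= k' <= i')%N /\ (j' <= l <= j)%N].
Proof.
move=> [ij [hij hk]] [ij' [hij' hk']] ii' jj' Pi Pi'.
(* Records are the times spent on the branch: up to [i'] the walk never goes below them again. *)
pose record r := forall m, (r <= m <= i')%N -> (height w r <= height w m)%N.
have partner r : (i <= r <= i')%N -> record r ->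
    exists2 l, matched w r l & (j' <= l <= j)%N.
  move=> ir rec.
  (* The partner is the first time from [j'] on whose height is at most that of [r]; heights change
     by at most one, so equality holds. *)
  have ex : exists l, (j' <= l)%N && (height w l <= height w r)%N.
    by exists j; rewrite jj' -hij; apply: hk; lia.
  case: (ex_minnP ex) => l /andP[jl hl] lmin; exists l; last first.
    by rewrite jl; apply: lmin; rewrite jj' -hij; apply: hk; lia.
  have gt k : (j' <= k < l)%N -> (height w r < height w k)%N.
    move=> /andP[jk kl]; rewrite ltnNge; apply/negP => hkr.
    by have := lmin k; rewrite jk hkr => /(_ isT); lia.
  have hr : (height w r <= height w i')%N by apply: rec; lia.
  have hl' : height w r = height w l.
    apply/eqP; rewrite eqn_leq hl andbT.
    move: jl; rewrite leq_eqVlt => /orP[/eqP <-|jl]; first by lia.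
    case: l jl hl lmin gt => [|l] jl hl lmin gt; first by lia.
    have := gt l ltac:(lia); have := height_step w l; lia.
  split; first by lia.
  split=> // k /andP[rk kl].
  have [ki|ki] := leqP k i'; first by apply: rec; lia.
  have [kj|kj] := leqP k j'; first by apply: leq_trans hr (hk' _ _); lia.
  have [kl'|kl'] := ltnP k l; first by apply: ltnW (gt _ _); lia.
  have -> : k = l by lia.
  by rewrite hl'.
have next n r : (i' - r <= n)%N -> (i <= r <= i')%N -> record r -> ~~ P r ->
  exists k k' l, [/\ ~~ P k, P k', w k = w k' \/ k' = k.+1, matched w k' l &
    (i <= k)%N /\ (k <= k' <= i')%N /\ (j' <= l <= j)%N].
  elim: n r => [|n IH] r rn ir rec Pr.
    have ri : r = i' by lia.
    by rewrite ri Pi' in Pr.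
  have ri : (r < i')%N.
    rewrite ltn_neqAle; have [ri|_] /= := eqVneq r i'; last by lia.
    by rewrite ri Pi' in Pr.
  suff [r' [rr' rec' wr]] : exists r', [/\ (r < r' <= i')%N, record r' &
      w r = w r' \/ r' = r.+1].
    have [Pr'|Pr'] := boolP (P r'); last by apply: (IH r') => //; lia.
    have [l rl jl] := partner r' ltac:(lia) rec'.
    by exists r, r', l; split => //; lia.
  (* A later visit at the same height is matched with [r]. If there is none, all later heights
     exceed that of [r], and [r.+1] is a record. *)
  have [[r' rr' hr']|nor] :=
      pselect (exists2 r', (r < r' <= i')%N & height w r' = height w r).
    exists r'; split=> //; first by move=> m rm; rewrite hr'; apply: rec; lia.
    left; apply: matched_eq; split; first by lia.
    by split=> // k rk; apply: rec; lia.
  have gt m : (r < m <= i')%N -> (height w r < height w m)%N.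
    move=> rm; rewrite ltn_neqAle rec ?andbT; last by lia.
    by apply/eqP => hm; apply: nor; exists m.
  exists r.+1; split; [lia| |by right].
  move=> m rm; apply: leq_trans (gt m _); last by lia.
  by have := height_step w r; lia.
by apply: (next (i' - i)%N i) => //; [lia|move=> m im; apply: hk; lia].
Qed.

End Reduction.

Local Open Scope ring_scope.

(** * Pairings of times induced by a null-homotopy *)

(* Without the clearing, [lia] diverges on the hypotheses about real numbers. *)
Ltac nlia := repeat match goal with
  | H : is_true (Order.le _ _) |- _ => clear H
  | H : is_true (Order.lt _ _) |- _ => clear H
  | H : _ = _ :> ?T |- _ => lazymatch T with nat => fail | _ => clear H end
  | H : forall _, _ |- _ => clear H
  | H : _ /\ _ |- _ => clear H
  | x := _ |- _ => clear x
  end; lia.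

(** Stated for any hereditary [P], so as to serve for covers, uniform continuity and local constancy
    of colourings alike. Halving the local radius leaves room for balls centred nearby. *)
Lemma lebesgue_number (R : realType) (T : pseudoMetricType R) (K : set T)
    (P : set T -> Prop) :
  (forall A B, A `<=` B -> P B -> P A) -> compact K ->
  (forall x, K x -> exists2 r : R, 0 < r & P (ball x r)) ->
  exists2 r : R, 0 < r & forall x, K x -> P (ball x r).
Proof.
move=> Pmono /compact_near_coveringP cK locP.
have : \forall r \near 0^'+, K `<=` [set x | P (ball x r)].
  apply: cK => x Kx; have [r r0 Px] := locP x Kx.
  have r20 : 0 < r / 2 by rewrite divr_gt0.
  exists (ball x (r / 2), [set d | d < r / 2]).
    by split; [exact: nbhsx_ballx|exact: nbhs_right_lt].
  move=> [y d] /= [xy dr]; apply: Pmono Px => z yz.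
  rewrite (splitr r); apply: ball_triangle xy _.
  exact: le_ball (ltW dr) _ yz.
move=> nearP.
have [r [r0 Pr]] : exists r : R, 0 < r /\ K `<=` [set x | P (ball x r)].
  near (0 : R)^'+ => r; exists r; split; first by near: r; exact: nbhs_right_gt.
  by near: r.
by exists r.
Unshelve. all: by end_near. Qed.

Lemma uniformly_continuous_compact (R : realType) (T : pseudoMetricType R)
    (X : metricType R) (K : set T) (f : T -> X) (e : R) :
  compact K -> {within K, continuous f} -> 0 < e ->
  exists2 d : R, 0 < d &
    forall x y, K x -> K y -> ball x d y -> mdist (f x) (f y) < e.
Proof.
move=> cK /subspace_continuousP cf e0.
have e20 : 0 < e / 2 by rewrite divr_gt0.
pose P (A : set T) := forall x y, A x -> A y -> K x -> K y ->
  mdist (f x) (f y) < e.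
have [||r r0 Pr] := @lebesgue_number R T K P _ cK.
- by move=> A B AB PB x y /AB Bx /AB By; exact: PB.
- move=> x Kx; have := cf x Kx (ball (f x) (e / 2)) (nbhsx_ballx _ _ e20).
  rewrite /= -nbhs_ballE => -[r /= r0 xr]; exists r => // y z xy xz Ky Kz.
  have := xr _ xy Ky; have := xr _ xz Kz; rewrite !ballEmdist /= => fz fy.
  rewrite (le_lt_trans (metric_triangle _ (f x) _))// (splitr e) ltrD//.
  by rewrite metric_sym.
exists r => // x y Kx Ky xy; apply: (Pr x Kx) => //; exact: ballxx.
Qed.

(* What remains of a cover of multiplicity 2 by sets of diameter less than [e]
   and with a positive Lebesgue number, once every point has chosen a member of
   the cover containing the ball around it. *)
Definition colorable (R : realType) (X : metricType R) (Y : set X) (e : R)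
    : Prop :=
  exists (T : eqType) (k : X -> T) (r : R), 0 < r /\
    (forall x y z, Y x -> Y y -> Y z ->
      mdist x y < r -> mdist y z < r -> mdist x z < r ->
      [|| k x == k y, k y == k z | k x == k z]) /\
    (forall x y, Y x -> Y y -> k x = k y -> mdist x y < e).

Definition thin (R : realType) (X : metricType R) (Y : set X) : Prop :=
  forall e : R, 0 < e -> colorable Y e.

(** The version of [lamination] with error [e]. The last clause is a discrete intermediate value
    property for the distance to [c x] on the way from an outer to an inner pair. *)
Definition coherent_pairing (R : realType) (X : metricType R) (u v : R)
    (c : R -> X) (e : R) (S : R -> R -> Prop) : Prop :=
  [/\ S u v,
      forall x y, S x y -> [/\ u <= x, x <= y, y <= v & mdist (c x) (c y) < e],
      forall t, u <= t <= v -> exists2 x, S x x & `|x - t| < e &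
      forall x y x' y' r, S x y -> S x' y' -> x <= x' -> x' <= y ->
        e <= r -> r <= mdist (c x) (c x') ->
        exists x'' y'', [/\ S x'' y'', x <= x'' <= x', y' <= y'' &
          r <= mdist (c x) (c x'') < r + e]].

Lemma adjacent_dist (R : realType) (f : nat -> R) (s d : R) a b b' :
  f a.+1 = f a + s -> 0 < s -> s < d -> (a <= b <= a.+1)%N ->
  (a <= b' <= a.+1)%N -> `|f b - f b'| < d.
Proof.
move=> fS s0 sd hb hb'.
have [->|->] : b = a \/ b = a.+1 by nlia.
  have [->|->] : b' = a \/ b' = a.+1 by nlia.
    by rewrite subrr normr0; lra.
  by rewrite fS opprD addNKr normrN gtr0_norm.
have [->|->] : b' = a \/ b' = a.+1 by nlia.
  by rewrite fS addrC addKr gtr0_norm.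
by rewrite subrr normr0; lra.
Qed.

Lemma coherent_pairing_of_nullhomotopy (R : realType) (X : metricType R)
    (u v : R) (c : R -> X) (x0 : X) (H : R * R -> X) (e : R) :
  u < v -> {within `[u, v] `*` `[0, 1], continuous H} ->
  thin (H @` (`[u, v] `*` `[0, 1])) ->
  (forall t, t \in `[u, v] -> H (t, 0) = c t /\ H (t, 1) = x0) ->
  (forall s, s \in `[0, 1] -> H (u, s) = c u /\ H (v, s) = c v) ->
  0 < e -> exists S, coherent_pairing u v c e S.
Proof.
move=> uv cH tH Hh Hv e0.
have cQ : compact (`[u, v] `*` `[(0 : R), 1]).
  by apply: compact_setX; exact: segment_compact.
have [T [k [r [r0 [tri kd]]]]] := tH e e0.
(* Neighbouring grid points with images closer than [l] meet both the scale [r] of the colouring and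
   the error [e]. *)
pose l := Num.min r e.
have l0 : 0 < l by rewrite lt_min r0.
have [d d0 Hd] := uniformly_continuous_compact cQ cH l0.
pose d' := Num.min d e.
have d'0 : 0 < d' by rewrite lt_min d0.
(* The numerator bounds both [v - u] and [1], so the grid is fine in both directions. *)
have [N [N0 Nd]] : exists N : nat, 0 < N%:R :> R /\ (v - u + 1) / N%:R < d'.
  exists (Num.truncn ((v - u + 1) / d')).+1; split; first by rewrite ltr0n.
  by rewrite ltr_pdivrMr// mulrC -ltr_pdivrMr// truncnS_gt.
pose tau (i : nat) : R := u + (v - u) * (i%:R / N%:R).
pose sig (i : nat) : R := i%:R / N%:R.
have sig01 i : (i <= N)%N -> 0 <= sig i <= 1.
  by move=> iN; rewrite /sig divr_ge0//= ler_pdivrMr// mul1r ler_nat.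
have tauuv i : (i <= N)%N -> u <= tau i <= v.
  move=> /sig01 /andP[s0 s1]; rewrite /tau -/(sig i); nra.
have sigS i : sig i.+1 = sig i + N%:R^-1.
  by rewrite /sig -natr1 mulrDl mul1r.
have tauS i : tau i.+1 = tau i + (v - u) / N%:R.
  by rewrite /tau -!/(sig _) sigS; ring.
have dN1 : N%:R^-1 < d'.
  apply: le_lt_trans Nd; rewrite -[leLHS]mul1r ler_pM2r ?invr_gt0//; lra.
have dN2 : (v - u) / N%:R < d'.
  apply: le_lt_trans Nd; rewrite ler_pM2r ?invr_gt0//; lra.
have dN20 : 0 < (v - u) / N%:R by rewrite divr_gt0// subr_gt0.
have dN10 : 0 < N%:R^-1 :> R by rewrite invr_gt0.
have d'd : d' <= d by rewrite /d' ge_min lexx.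
have d'e : d' <= e by rewrite /d' ge_min lexx orbT.
have lr : l <= r by rewrite /l ge_min lexx.
have le' : l <= e by rewrite /l ge_min lexx orbT.
have tau_le i j : (tau i <= tau j) = (i <= j)%N.
  by rewrite /tau lerD2l ler_pM2l ?subr_gt0// ler_pM2r ?invr_gt0// ler_nat.
have tau0 : tau 0%N = u by rewrite /tau mul0r mulr0 addr0.
have tauN : tau N = v by rewrite /tau divff ?gt_eqF// mulr1 addrC subrK.
have sig0 : sig 0%N = 0 by rewrite /sig mul0r.
have sigN : sig N = 1 by rewrite /sig divff// gt_eqF.
pose z q p := H (tau p, sig q).
have zQ q p : (q <= N)%N -> (p <= N)%N ->
    (`[u, v] `*` `[(0 : R), 1]) (tau p, sig q).
  by move=> qN pN; split=> /=; rewrite in_itv /=; [exact: tauuv|exact: sig01].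
have zdist q p q' p' : (q <= N)%N -> (p <= N)%N -> (q' <= N)%N -> (p' <= N)%N ->
    `|tau p - tau p'| < d -> `|sig q - sig q'| < d ->
    mdist (z q p) (z q' p') < l.
  by move=> qN pN qN' pN' dt ds; apply: Hd; [exact: zQ|exact: zQ|split].
have cu : c u = x0.
  have /= [<- _] := Hv 1 ltac:(by rewrite in_itv /= ler01 lexx).
  by have [] := Hh u ltac:(by rewrite in_itv /= lexx ltW).
have cv : c v = x0.
  have /= [_ <-] := Hv 1 ltac:(by rewrite in_itv /= ler01 lexx).
  by have [] := Hh v ltac:(by rewrite in_itv /= lexx ltW).
pose w q p := k (z q p).
have z0 p : (p <= N)%N -> z 0%N p = c (tau p).
  by move=> /tauuv tp; rewrite /z sig0; case: (Hh (tau p)).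
have walkN : walk (w 0%N) N = [:: k x0].
  apply: (@walk_null_grid _ w N N (k x0)).
  - move=> q /sig01 sq; rewrite /w /z tau0.
    by case: (Hv (sig q)) => // -> _; rewrite cu.
  - move=> q /sig01 sq; rewrite /w /z tauN.
    by case: (Hv (sig q)) => // _ ->; rewrite cv.
  - move=> p /tauuv tp; rewrite /w /z sigN.
    by case: (Hh (tau p)) => // _ ->.
  move=> q p qN pN.
  have zz q' p' : (q <= q' <= q.+1)%N -> (p <= p' <= p.+1)%N ->
    forall q'' p'', (q <= q'' <= q.+1)%N -> (p <= p'' <= p.+1)%N ->
    mdist (z q' p') (z q'' p'') < r.
    move=> hq' hp' q'' p'' hq'' hp''.
    apply: lt_le_trans lr; apply: zdist; try nlia.
      by apply: adjacent_dist (tauS p) _ _ hp' hp''; lra.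
    by apply: adjacent_dist (sigS q) _ _ hq' hq''; lra.
  have zY q' p' : (q' <= N)%N -> (p' <= N)%N ->
      (H @` (`[u, v] `*` `[0, 1])) (z q' p').
    by move=> qN' pN'; exists (tau p', sig q') => //; exact: zQ.
  by apply/andP; split; apply: tri; (apply: zY || apply: zz); nlia.
have walk0 : walk (w 0%N) 0 = [:: k x0] by rewrite /= /w z0// tau0 cu.
(* The pairing consists of the matched times of the bottom row, on which [H] is [c]. *)
exists (fun x y => exists i j, [/\ x = tau i, y = tau j, (j <= N)%N &
  matched (w 0%N) i j]).
have kc i j : (i <= N)%N -> (j <= N)%N -> w 0%N i = w 0%N j ->
    mdist (c (tau i)) (c (tau j)) < e.
  have cY p : (p <= N)%N -> (H @` (`[u, v] `*` `[0, 1])) (c (tau p)).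
    move=> pN; exists (tau p, 0); last by rewrite -z0// /z sig0.
    by split; rewrite /= in_itv /=; [exact: tauuv|rewrite lexx ler01].
  by move=> iN jN; rewrite /w !z0// => /kd; apply; exact: cY.
split.
- exists 0%N, N; split=> //; split=> //; rewrite /height walk0 walkN.
  split=> //.
  move=> p _; have := ohead_walk (w 0%N) p.
  by case: (walk _ _).
- move=> x y [i [j [-> -> jN m]]].
  have ij : (i <= j)%N by case: m.
  have iN : (i <= N)%N by nlia.
  have /andP[ui _] := tauuv _ iN; have /andP[_ jv] := tauuv _ jN.
  by split=> //; [rewrite tau_le|apply: kc => //; exact: matched_eq].
- move=> t /andP[ut tv].
  pose i := Num.truncn ((t - u) / (v - u) * N%:R).
  have x0' : 0 <= (t - u) / (v - u) * N%:R.
    by rewrite mulr_ge0 ?divr_ge0// subr_ge0// ltW.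
  have /andP[i1 i2] := truncn_itv x0'.
  have uv0 : 0 < v - u by rewrite subr_gt0.
  have iN : (i <= N)%N.
    rewrite -(ler_nat R); apply: le_trans i1 _.
    rewrite -[leRHS]mul1r ler_pM2r// ler_pdivrMr// mul1r; lra.
  exists (tau i); first by exists i, i; split=> //; exact: matched_refl.
  have t1 : tau i <= t.
    rewrite /tau -lerBrDl mulrC -ler_pdivlMr// ler_pdivrMr//.
  have t2 : t < tau i.+1.
    rewrite /tau -ltrBlDl [ltRHS]mulrC -ltr_pdivrMr// ltr_pdivlMr//.
  rewrite tauS in t2; rewrite ltr_norml; lra.
- move=> x y x' y' s [i [j [-> -> jN m]]] [i' [j' [-> -> jN' m']]].
  rewrite !tau_le => ii' i'j es sd.
  have [ij ij'] : (i <= j)%N /\ (i' <= j')%N by case: m; case: m'.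
  (* Otherwise the pairs cross, so [x] and [x'] have the same colour and images closer than [e],
     against [e <= s]. *)
  have jj' : (j' <= j)%N.
    rewrite leqNgt; apply/negP => jj'.
    have := matched_crossing m m' ii' i'j (ltnW jj').
    move=> /kc => /(_ ltac:(nlia) ltac:(nlia)); lra.
  (* Where the distance to [c x] first reaches [s], the last step joins times of equal colour or
     adjacent times, so it overshoots by less than [e]. *)
  have [||a [a' [b [Pa Pa' aa' mab [ia [ai jb]]]]]] := @matched_intermediate _ _
     (fun n => s <= mdist (c (tau i)) (c (tau n))) _ _ _ _ m m' ii' jj'.
  - by rewrite mdistxx -ltNge; lra.
  - by [].
  exists (tau a'), (tau b); split.
  - by exists a', b; split=> //; nlia.
  - by rewrite !tau_le; nlia.
  - by rewrite tau_le; nlia.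
  rewrite Pa' /=; rewrite -ltNge in Pa.
  suff aae : mdist (c (tau a)) (c (tau a')) < e.
    by apply: le_lt_trans (metric_triangle _ (c (tau a)) _) _; rewrite ltrD.
  case: aa' => [/kc->//|a'E]; try nlia.
  apply: lt_le_trans le'; rewrite -!z0; try nlia.
  apply: zdist; try nlia; last by rewrite subrr normr0.
  by rewrite a'E tauS opprD addNKr normrN gtr0_norm//; lra.
Qed.

(** * Limits of coherent pairings *)

(** A cluster point of an ultrafilter is a limit, since every set or its complement is a member. *)
Lemma ultra_compact_cvg (T : Type) (X : topologicalType) (U : set_system T)
    (f : T -> X) (K : set X) :
  UltraFilter U -> compact K -> U (f @^-1` K) ->
  exists2 p, K p & f @ U --> p.
Proof.
move=> UU cK UK; have [p [Kp cp]] := cK (f @ U) _ UK; exists p => // A pA.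
have [//|UnA] := in_ultra_setVsetC (f @^-1` A) UU.
by have [q [nAq Aq]] := cp (~` A) A UnA pA.
Qed.

(** Pairs stand for repeated visits to one point of a dendrite; the last clause expresses that its
    branches have no jumps. *)
Definition lamination (R : realType) (X : Type) (u v : R) (c : R -> X)
    (L : R -> R -> Prop) : Prop :=
  [/\ L u v,
      forall x y, L x y -> [/\ u <= x, x <= y, y <= v & c x = c y],
      forall t, u <= t <= v -> L t t,
      closed [set p : R * R | L p.1 p.2] &
      forall x y x' y', L x y -> L x' y' -> x <= x' -> x' <= y ->
        c x <> c x' -> exists x'' y'', [/\ L x'' y'', x < x'' < x' & y' < y'']].

Lemma lamination_of_coherent_pairings (R : realType) (X : metricType R)
    (u v : R) (c : R -> X) :
  {within `[u, v], continuous c} ->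
  (forall e : R, 0 < e -> exists S, coherent_pairing u v c e S) ->
  exists L, lamination u v c L.
Proof.
move=> cc cS.
have uc (e : R) : 0 < e -> exists2 d : R, 0 < d & forall x y,
    u <= x <= v -> u <= y <= v -> `|x - y| < d -> mdist (c x) (c y) < e.
  move=> e0.
  have [d d0 hd] := uniformly_continuous_compact (@segment_compact _ u v) cc e0.
  by exists d => // x y xI yI; apply: hd; rewrite /= in_itv.
have [eps eps0 epsc] : exists2 eps : nat -> R, forall n, 0 < eps n &
    forall e, 0 < e -> \forall n \near \oo, eps n < e.
  exists (fun n => n.+1%:R^-1) => [n|e e0]; first by rewrite invr_gt0.
  exact: near_infty_natSinv_lt (PosNum e0).
have /choice[S cohS] : forall n, exists S, coherent_pairing u v c (eps n) S.
  by move=> n; exact: cS.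
(* A single ultrafilter makes the approximations of several pairs available at common [n], and gives
   limits without subsequences. *)
have [U [UU sU]] := @ultraFilterLemma nat \oo _.
have small (e : R) : 0 < e -> U [set n | eps n < e].
  by move=> e0; apply: sU; exact: epsc.
pose near_pair x y (d : R) n :=
  exists p : R * R, [/\ S n p.1 p.2, `|x - p.1| < d & `|y - p.2| < d].
pose L x y := forall d, 0 < d -> U (near_pair x y d).
have Lprop x y : L x y -> [/\ u <= x, x <= y, y <= v & c x = c y].
  move=> Lxy.
  have ux : u <= x.
    rewrite leNgt; apply/negP => xu.
    have /Lxy/filter_ex[n [[i j] /= [Sij]]] : 0 < u - x by rewrite subr_gt0.
    have [_ pr _ _] := cohS n; have [? ? ? _] := pr _ _ Sij.
    by rewrite !ltr_norml => /andP[? ?]; lra.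
  have yv : y <= v.
    rewrite leNgt; apply/negP => xu.
    have /Lxy/filter_ex[n [[i j] /= [Sij]]] : 0 < y - v by rewrite subr_gt0.
    have [_ pr _ _] := cohS n; have [? ? ? _] := pr _ _ Sij.
    by rewrite !ltr_norml => _ /andP[? ?]; lra.
  have xy : x <= y.
    rewrite leNgt; apply/negP => xy.
    have /Lxy/filter_ex[n [[i j] /= [Sij]]] : 0 < (x - y) / 2.
      by rewrite divr_gt0// subr_gt0.
    have [_ pr _ _] := cohS n; have [? ? ? _] := pr _ _ Sij.
    by rewrite !ltr_norml => /andP[? ?] /andP[? ?]; lra.
  split=> //; apply: contrapT => /eqP; rewrite -mdist_gt0.
  set D := mdist _ _ => D0.
  have D3 : 0 < D / 3 by lra.
  have [d d0 hd] := uc _ D3.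
  have [n [[[i j] /= [Sij xi yj]] /= nD]] :=
    filter_ex (filterI (Lxy d d0) (small _ D3)).
  have [_ pr _ _] := cohS n; have [? ? ? cij] := pr _ _ Sij.
  have h1 : mdist (c x) (c i) < D / 3 by apply: hd => //; lra.
  have h2 : mdist (c y) (c j) < D / 3 by apply: hd => //; lra.
  have := metric_triangle (c x) (c i) (c y).
  have := metric_triangle (c i) (c j) (c y).
  rewrite (metric_sym (c j)) -/D.
  move: h1 h2 cij nD; set A := mdist _ _; set B := mdist _ _; lra.
exists L; split=> //.
- move=> d d0; apply: filterS filterT => n _; exists (u, v) => /=.
  by rewrite !subrr normr0; split=> //; case: (cohS n).
- move=> t tuv d d0; apply: filterS (small d d0) => n nd /=.
  have [_ _ rf _] := cohS n; have [x Sxx xt] := rf t tuv.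
  by exists (x, x); split=> //=; rewrite distrC (lt_trans xt).
- move=> [x y] /= cl d d0.
  have d20 : 0 < d / 2 by rewrite divr_gt0.
  have [[x' y'] [/= Lxy [/= xx yy]]] := cl _ (nbhsx_ballx (x, y) _ d20).
  apply: filterS (Lxy _ d20) => n [[i j] /= [Sij xi yj]].
  exists (i, j); split=> //=; rewrite (splitr d).
    by rewrite (le_lt_trans (ler_distD x' _ _))// ltrD.
  by rewrite (le_lt_trans (ler_distD y' _ _))// ltrD.
(* The discrete clause is used at level [D / 2]. The image of the limit pair stays away from both
   [c x] and [c x'], which makes the inequalities strict. *)
move=> x y x' y' Lxy Lxy' xx' x'y /eqP; rewrite -mdist_gt0.
set D := mdist _ _ => D0.
have [ux xy yv cxy] := Lprop _ _ Lxy; have [ux' xy' yv' cxy'] := Lprop _ _ Lxy'.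
have xltx' : x < x'.
  rewrite lt_neqAle xx' andbT; apply/eqP => xE.
  by move: D0; rewrite /D xE mdistxx ltxx.
have x'lty : x' < y.
  rewrite lt_neqAle x'y andbT; apply/eqP => xE.
  by move: D0; rewrite /D cxy xE mdistxx ltxx.
have D12 : 0 < D / 12 by lra.
have [d0 d00 hd] := uc _ D12.
(* The last two bounds keep the approximating times in the order [i <= i' <= j]; the bound [d0 / 2]
   lets two errors [d] add up. *)
have [d [dd d1 d2 d3]] : exists d : R,
    [/\ 0 < d, d <= d0 / 2, d <= (x' - x) / 2 & d <= (y - x') / 2].
  exists (Num.min (d0 / 2) (Num.min ((x' - x) / 2) ((y - x') / 2))).
  by rewrite !lt_min !ge_min !lexx !orbT; split=> //; lra.
(* The level [D / 2], with one error [D / 12] from continuity and one from [eps n], stays between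
   [D / 3] and [2 * D / 3]. *)
pose good n (p : R * R) := [/\ S n p.1 p.2, x - d < p.1 < x' + d, y' - d < p.2 &
  D / 3 <= mdist (c x) (c p.1) <= 2 * D / 3].
have Ugood : U [set n | exists p, good n p].
  apply: filterS (filterI (small _ D12) (filterI (Lxy d dd) (Lxy' d dd))).
  move=> n [/= nD [[[i j] /= [Sij xi yj]] [[i' j'] /= [Sij' xi' yj']]]].
  have [_ pr _ mid] := cohS n.
  have [ui ij jv _] := pr _ _ Sij; have [ui' ij' jv' _] := pr _ _ Sij'.
  have cxi : mdist (c x) (c i) < D / 12 by apply: hd; lra.
  have cxi' : mdist (c x') (c i') < D / 12 by apply: hd; lra.
  rewrite !ltr_norml in xi yj xi' yj'.
  have tr1 := metric_triangle (c x) (c i) (c x').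
  have tr2 := metric_triangle (c i) (c i') (c x').
  rewrite -/D in tr1; rewrite (metric_sym (c i') (c x')) in tr2.
  have [||||x'' [y'' [Sxy xi'' jy'' md]]] :=
    mid i j i' j' (D / 2) Sij Sij'; try lra.
  exists (x'', y''); split=> //=; try lra.
  have tr3 := metric_triangle (c i) (c x) (c x'').
  have tr4 := metric_triangle (c x) (c i) (c x'').
  rewrite (metric_sym (c i) (c x)) in tr3; lra.
(* [(0, 0)] is only a default for those [n] that have no good pair. *)
have /choice[f fgood] : forall n, exists p, (exists p', good n p') -> good n p.
  move=> n; have [[p gp]|no] := pselect (exists p', good n p').
    by exists p.
  by exists (0, 0).
have cK : compact (`[u, v] `*` `[u, v]).
  by apply: compact_setX; exact: segment_compact.
have [|[x'' y''] [/= ux'' uy''] cvf] := ultra_compact_cvg (f := f) UU cK.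
  apply: filterS Ugood => n /fgood[Sn _ _ _].
  have [_ pr _ _] := cohS n; have [? ? ? _] := pr _ _ Sn.
  by split; rewrite /= in_itv /=; lra.
rewrite !in_itv /= in ux'' uy''.
have near_f e : 0 < e -> U [set n | ball (x'', y'') e (f n) /\ good n (f n)].
  move=> e0; apply: filterI; first by apply: cvf; exact: nbhsx_ballx.
  by apply: filterS Ugood => n; exact: fgood.
have Lxy'' : L x'' y''.
  move=> e e0; apply: filterS (near_f e e0) => n [[/= bx bY] [Sn _ _ _]].
  by exists (f n).
have [_ xy'' _ cxy''] := Lprop _ _ Lxy''.
have [n [[/= bx bY] [Sn xf yf mf]]] := filter_ex (near_f d dd).
have [_ pr _ _] := cohS n; have [uf ff fv _] := pr _ _ Sn.
have cf : mdist (c x'') (c (f n).1) < D / 12.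
  by apply: hd => //; try lra; apply: lt_le_trans bx _; lra.
rewrite /ball /= !ltr_norml in bx bY.
have tr3 := metric_triangle (c x) (c x'') (c (f n).1).
have tr4 := metric_triangle (c x) (c (f n).1) (c x'').
rewrite (metric_sym (c (f n).1)) in tr4.
exists x'', y''; split=> //.
  apply/andP; split; rewrite ltNge; apply/negP => h.
    have : mdist (c x) (c x'') < D / 12 by apply: hd; rewrite ?ltr_norml; lra.
    lra.
  have : mdist (c x'') (c x') < D / 12 by apply: hd; rewrite ?ltr_norml; lra.
  have := metric_triangle (c x) (c x'') (c x'); rewrite -/D; lra.
rewrite ltNge; apply/negP => h.
have : mdist (c y'') (c y') < D / 12 by apply: hd; rewrite ?ltr_norml; lra.
rewrite -cxy'' -cxy'.
have := metric_triangle (c x) (c x'') (c x'); rewrite -/D; lra.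
Qed.

(** * Truncating a loop along a lamination *)

Section Truncation.
Variables (R : realType) (X : metricType R) (u v : R) (c : R -> X).
Variable L : R -> R -> Prop.
Hypotheses (uv : u < v) (cc : {within `[u, v], continuous c}).
Hypothesis lamL : lamination u v c L.

(** Pairs enclosing [t] correspond to the points of the branch leading to the position at time [t];
    the bound [r] keeps those already met when the loop is cut at [r]. *)
Definition spans (r t x : R) : Prop :=
  [/\ x <= r, x <= t & exists2 y, t <= y & L x y].

Definition last_span (r t x : R) : Prop :=
  spans r t x /\ forall x', spans r t x' -> x' <= x.

(** The admissible pairs form a compact set containing [(u, v)], on which the first coordinate
    attains its maximum. *)
Lemma last_span_exists r t : u <= r <= v -> u <= t <= v ->
  exists x, last_span r t x.
Proof.
case: lamL => Luv Lp _ Lcl _ /andP[ur rv] /andP[ut tv].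
have cK : compact (`[u, v] `*` `[u, v]).
  by apply: compact_setX; exact: segment_compact.
pose K := [set p : R * R | L p.1 p.2] `&` [set p : R * R | p.1 <= r] `&`
  [set p : R * R | p.1 <= t] `&` [set p : R * R | t <= p.2].
have clK : closed K.
  apply: closedI; [apply: closedI; [apply: closedI => //|]|].
  - apply: (@closed_comp _ _ fst [set x | x <= r]) => [x _|].
      exact: cvg_fst.
    exact: closed_le.
  - apply: (@closed_comp _ _ fst [set x | x <= t]) => [x _|].
      exact: cvg_fst.
    exact: closed_le.
  - apply: (@closed_comp _ _ snd [set x | t <= x]) => [x _|].
      exact: cvg_snd.
    exact: closed_ge.
have compK : compact K.
  apply: (subclosed_compact clK cK) => -[x y] [[[/= /Lp[ux xy yv _] _] _] _].
  by split; rewrite /= in_itv /=; lra.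
have [||[x y]] := @compact_EVT_max _ R fst K _ compK.
- by exists (u, v).
- by apply: continuous_subspaceT => x; exact: cvg_fst.
rewrite inE => -[[[/= Lxy xr] xt] ty] mx.
exists x; split; first by split=> //; exists y.
move=> x' [x'r x't [y' ty' Lxy']].
by apply: (mx (x', y')); rewrite inE.
Qed.

(** The time [x] may jump; its image does not. A candidate pair whose image differs is, for all
    nearby parameters, either inadmissible or beaten by an intermediate pair, and compactness makes
    this uniform over the candidates. *)
Lemma last_span_continuous r t x (e : R) :
  u <= r <= v -> u <= t <= v -> last_span r t x -> 0 < e ->
  exists2 d : R, 0 < d & forall r' t' x', u <= r' <= v -> u <= t' <= v ->
    `|r - r'| < d -> `|t - t'| < d -> last_span r' t' x' ->
    mdist (c x) (c x') < e.
Proof.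
case: lamL => Luv Lp _ Lcl Lmid rI tI [[xr xt [y ty Lxy]] xmax] e0.
have [ux xy yv cxy] := Lp _ _ Lxy.
have /compact_near_coveringP cK : compact (`[u, v] `*` `[u, v]).
  by apply: compact_setX; exact: segment_compact.
pose P (p q : R * R) := L q.1 q.2 -> q.1 <= p.1 -> q.1 <= p.2 -> p.2 <= q.2 ->
  (forall x', spans p.1 p.2 x' -> x' <= q.1) -> mdist (c x) (c q.1) < e.
have : \forall p \near (r, t), (`[u, v] `*` `[u, v]) `<=` P p.
  apply: (cK _ (nbhs (r, t)) P) => q qK.
  suff [d d0 hd] : exists2 d : R, 0 < d &
      forall q' p, ball q d q' -> ball (r, t) d p -> P p q'.
    exists (ball q d, ball (r, t) d); last first.
      by move=> [q' p] /= [? ?]; exact: hd.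
    by split; exact: nbhsx_ballx.
  have [Lq|nLq] := pselect (L q.1 q.2); last first.
    have /nbhs_ballP[d /= d0 hd] : nbhs q (~` [set p : R * R | L p.1 p.2]).
      by apply: open_nbhs_nbhs; split=> //; exact: closed_openC.
    by exists d => // q' p /hd qq' _ /qq'.
  have [uq qq qv cqq] := Lp _ _ Lq.
  have [rq|qr] := ltP r q.1.
    exists ((q.1 - r) / 2); first lra.
    move=> q' p [] /=; rewrite /ball /= !ltr_norml => ? ? [] /=.
    rewrite /ball /= !ltr_norml => ? ? _ ?; lra.
  have [tq|qt] := ltP t q.1.
    exists ((q.1 - t) / 2); first lra.
    move=> q' p [] /=; rewrite /ball /= !ltr_norml => ? ? [] /=.
    rewrite /ball /= !ltr_norml => ? ? _ _ ?; lra.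
  have [qt2|tq2] := ltP q.2 t.
    exists ((t - q.2) / 2); first lra.
    move=> q' p [] /=; rewrite /ball /= !ltr_norml => ? ? [] /=.
    rewrite /ball /= !ltr_norml => ? ? _ _ _ ?; lra.
  have qx : q.1 <= x by apply: xmax; split=> //; exists q.2.
  have [cE|cN] := pselect (c q.1 = c x).
    have [d d0 hd] :=
      uniformly_continuous_compact (@segment_compact _ u v) cc e0.
    exists d => // q' p [/= qq' _] _ /Lp[? ? ? _] _ _ _ _.
    by rewrite -cE; apply: hd => //=; rewrite in_itv /=; lra.
  (* The intermediate pair satisfies the inequalities of [spans] strictly, so it survives small
     changes of [r] and [t] and starts later than any candidate near [q]. *)
  have [x'' [y'' [Lxy'' /andP[qx'' x''x] yy'']]] :=
    Lmid _ _ _ _ Lq Lxy qx (le_trans xt tq2) cN.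
  have [d [d0 d1 d2 d3]] : exists d : R, [/\ 0 < d, d <= x'' - q.1,
      d <= x - x'' & d <= y'' - y].
    exists (Num.min (x'' - q.1) (Num.min (x - x'') (y'' - y))).
    by rewrite !lt_min !ge_min !lexx !orbT; split=> //; lra.
  exists d => // q' p [] /=; rewrite /ball /= !ltr_norml => qq' _ [] /=.
  rewrite /ball /= !ltr_norml => pr pt _ _ _ _ sp.
  suff : x'' <= q'.1 by lra.
  by apply: sp; split; [lra|lra|exists y'' => //; lra].
move=> /nbhs_ballP[d /= d0 hd]; exists d => // r' t' x' r'I t'I rr' tt'.
move=> [[x'r x't [y' ty' Lxy']] x'max].
have [? ? ? _] := Lp _ _ Lxy'.
apply: (hd (r', t') _ (x', y')) => //=.
by split; rewrite /= in_itv /=; lra.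
Qed.

(* At time [s] the loop runs up to time [r = v - s (v - u)] only, and then goes
   back to its base point through the positions [c x], [x] being the last time
   before [r] which is paired with a time after the current one. *)
Lemma nullhomotopic_of_lamination : nullhomotopic_in (c @` `[u, v]) u v c.
Proof.
case: (lamL) => Luv Lp Lrefl _ _; have u_lt_v := uv.
pose rho s := v - s * (v - u).
have rhoI s : 0 <= s <= 1 -> u <= rho s <= v.
  move=> /andP[s0 s1]; have vu : 0 <= v - u by lra.
  have := mulr_ge0 s0 vu; have := ler_wpM2r vu s1; rewrite /rho; lra.
have /choice[f fP] : forall p : R * R, exists x,
    u <= p.1 <= v -> u <= p.2 <= v -> last_span p.1 p.2 x.
  move=> p; have [[h1 h2]|h] := pselect (u <= p.1 <= v /\ u <= p.2 <= v).
    by have [x xP] := last_span_exists h1 h2; exists x.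
  by exists 0 => h1 h2; case: h.
have fI r t : u <= r <= v -> u <= t <= v -> u <= f (r, t) <= v.
  move=> rI tI; have [[_ _ [y _ /Lp[? ? ? _]]] _] := fP (r, t) rI tI; lra.
have uu : u <= u <= v by lra.
have vv : u <= v <= v by lra.
have fr r t x : u <= r <= v -> u <= t <= v -> last_span r t x -> f (r, t) = x.
  move=> rI tI [sx mx]; have [sf mf] := fP (r, t) rI tI.
  by apply/eqP; rewrite eq_le mf// mx.
exists (c u), (fun p => c (f (rho p.2, p.1))); split.
- apply/subspace_continuousP => -[t s] [/=]; rewrite !in_itv /= => tI sI U.
  rewrite -nbhs_ballE => -[e /= e0 eU].
  have [d d0 hd] := last_span_continuous (rhoI _ sI) tI
    (fP (rho s, t) (rhoI _ sI) tI) e0.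
  have vu0 : 0 < v - u + 1 by lra.
  have k0 : 0 < Num.min d (d / (v - u + 1)) by rewrite lt_min d0 divr_gt0.
  rewrite -nbhs_ballE; exists (Num.min d (d / (v - u + 1))) => //= -[t' s'].
  move=> [tt0 ss0] [/=].
  have tt' : `|t - t'| < d by apply: lt_le_trans tt0 _; rewrite ge_min lexx.
  have ss' : `|s - s'| < d / (v - u + 1).
    by apply: lt_le_trans ss0 _; rewrite ge_min lexx orbT.
  rewrite !in_itv /= => t'I s'I; apply: eU; rewrite ballEmdist /=.
  apply: hd (rhoI _ s'I) t'I _ tt' (fP (rho s', t') (rhoI _ s'I) t'I).
  have -> : rho s - rho s' = (s' - s) * (v - u) by rewrite /rho; ring.
  rewrite normrM distrC (gtr0_norm (_ : 0 < v - u)); last lra.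
  rewrite ltr_pdivlMr// in ss'.
  apply: le_lt_trans ss'; rewrite ler_wpM2l//; lra.
- move=> _ [[t s] [/= tI sI] <-].
  rewrite in_itv /= in tI; rewrite in_itv /= in sI.
  by exists (f (rho s, t)); rewrite //= in_itv /= fI// rhoI.
(* For [r = v] the degenerate pair [(t, t)] is last; for [r = u] the pair [(u, v)] is, and the loop
   has become constant. *)
- move=> t; rewrite in_itv /= => tI; split=> /=.
    rewrite /rho mul0r subr0 (fr v t t)//.
    by split; [split; [lra|lra|exists t => //; exact: Lrefl]|move=> x' [_ ? _]].
  rewrite /rho mul1r opprB addrC subrK (fr u t u)//.
  split; last by move=> x' [? _ _].
  by split; [lra|lra|exists v => //; lra].
- move=> s; rewrite in_itv /= => sI; have rI := rhoI _ sI; split.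
    rewrite (fr (rho s) u u)//; split; last by move=> x' [_ ? _].
    by split; [lra|lra|exists u => //; exact: Lrefl].
  (* A span of [v] may start before [v], but its pair ends at [v], so the image is still [c v]. *)
  have [[_ _ [y vy Lf]] _] := fP (rho s, v) rI vv.
  have [_ _ yv ->] := Lp _ _ Lf.
  by congr c; apply/eqP; rewrite eq_le yv vy.
Qed.

End Truncation.

(** * Consequences of one-dimensionality *)

Lemma mdist_ball_lt (R : realType) (X : metricType R) (e : R) (x y z : X) :
  ball x (e / 2) y -> ball x (e / 2) z -> mdist y z < e.
Proof.
rewrite !ballEmdist /= => xy xz.
by rewrite (le_lt_trans (metric_triangle _ x _))// metric_sym (splitr e) ltrD.
Qed.

Lemma open_metric_ball (R : realType) (X : metricType R) (x : X) (e : R) :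
  open (ball x e).
Proof.
rewrite openE => y; rewrite ballEmdist /= => xy.
rewrite /interior; apply/nbhs_ballP; exists (e - mdist x y) => /=.
  by rewrite subr_gt0.
move=> z; rewrite ballEmdist /= => yz.
by apply: le_lt_trans (metric_triangle _ y _) _; lra.
Qed.

Lemma open_cover_balls (R : realType) (X : metricType R) (e : R) : 0 < e ->
  open_cover (range (fun x : X => ball x e)).
Proof.
move=> e0; split; first by move=> _ [x _ <-]; exact: open_metric_ball.
apply/seteqP; split=> // x _; exists (ball x e); first by exists x.
exact: ballxx.
Qed.

Lemma multiplicity_le2 (T : Type) (C : set (set T)) (x : T) (A1 A2 A3 : set T) :
  multiplicity_le 2 C -> C A1 -> C A2 -> C A3 -> A1 x -> A2 x -> A3 x ->
  [|| A1 == A2, A2 == A3 | A1 == A3].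
Proof.
move=> /(_ x)/card_leP[f] C1 C2 C3 x1 x2 x3.
pose i A (CA : C A) (Ax : A x) : nat :=
  \val (f (exist _ A (mem_set (conj CA Ax)))).
have hi A B (CA : C A) (Ax : A x) (CB : C B) (Bx : B x) :
    i A CA Ax = i B CB Bx -> A = B.
  by move=> /val_inj /(inj (in_setT _) (in_setT _)) /(congr1 val).
have lt A (CA : C A) (Ax : A x) : (i A CA Ax < 2)%N.
  exact: (set_valP (f (exist _ A (mem_set (conj CA Ax))))).
have := hi _ _ C1 x1 C2 x2; have := hi _ _ C2 x2 C3 x3.
have := hi _ _ C1 x1 C3 x3.
have := lt _ C1 x1; have := lt _ C2 x2; have := lt _ C3 x3.
move: (i A1 _ _) (i A2 _ _) (i A3 _ _) => a b c.
move=> c2 b2 a2 e13 e23 e12.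
have [ab|[bc|ac]] : a = b \/ b = c \/ a = c by lia.
- by rewrite (e12 ab) eqxx.
- by rewrite (e23 bc) eqxx orbT.
- by rewrite (e13 ac) eqxx !orbT.
Qed.

(** Each point is coloured by a member containing its [r]-ball. Of three mutually close points, one
    lies in all three members, so two of these coincide. *)
Lemma coloring_of_cover (R : realType) (X : metricType R) (Y : set X)
    (C : set (set X)) (e r : R) :
  0 < r -> refines C (range (fun x : X => ball x (e / 2))) ->
  multiplicity_le 2 C ->
  (forall x, Y x -> exists2 A, C A & ball x r `<=` A) ->
  colorable Y e.
Proof.
move=> r0 Cref Cmult Cleb.
have /choice[k kP] : forall x, exists A, Y x -> C A /\ ball x r `<=` A.
  move=> x; have [Yx|nYx] := pselect (Y x); last by exists set0.
  by have [A CA xA] := Cleb x Yx; exists A.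
exists (set X : eqType), k, r; split=> //; split.
- move=> x y z Yx Yy Yz xy yz xz.
  have [Cx bx] := kP x Yx; have [Cy By] := kP y Yy; have [Cz bz] := kP z Yz.
  apply: (@multiplicity_le2 _ C y) => //.
  + by apply: bx; rewrite ballEmdist.
  + exact/By/ballxx.
  + by apply: bz; rewrite ballEmdist /= metric_sym.
- move=> x y Yx Yy kxy.
  have [Cx bx] := kP x Yx; have [_ By] := kP y Yy.
  have [_ [w _ <-] sub] := Cref _ Cx.
  apply: (@mdist_ball_lt _ _ _ w); apply: sub; first exact/bx/ballxx.
  by rewrite kxy; exact/By/ballxx.
Qed.

Lemma thin_of_ucov_lt (R : realType) (X : metricType R) (Y : set X) :
  ucov_lt 2 X -> thin Y.
Proof.
move=> dimX e e0; have e20 : 0 < e / 2 by rewrite divr_gt0.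
have [|C [[_ [r r0 rC]] Cref Cm]] := dimX (range (fun x : X => ball x (e / 2))).
  split; first exact: open_cover_balls.
  by exists (e / 2) => // _ [x _ <-]; exists (ball x (e / 2)) => //; exists x.
apply: (coloring_of_cover r0 Cref Cm) => x _.
by have [|A CA xA] := rC (ball x r); [exists x|exists A].
Qed.

(** Compactness of [Y] supplies the Lebesgue number that a uniform cover has by definition. *)
Lemma thin_of_cov_lt (R : realType) (X : metricType R) (Y : set X) :
  compact Y -> cov_lt 2 X -> thin Y.
Proof.
move=> cY dimX e e0; have e20 : 0 < e / 2 by rewrite divr_gt0.
have [C [[Co Ccov] Cref Cm]] := dimX _ (open_cover_balls X e20).
have [||r r0 hr] := @lebesgue_number R X Y
    (fun B => exists2 A, C A & B `<=` A) _ cY.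
- by move=> A B AB [D CD BD]; exists D => //; exact: subset_trans BD.
- move=> x Yx; have [A CA Ax] : (\bigcup_(A in C) A) x by rewrite Ccov.
  have /nbhs_ballP[r /= r0 xA] : nbhs x A.
    by apply: open_nbhs_nbhs; split=> //; exact: Co.
  by exists r => //; exists A.
exact: (coloring_of_cover r0 Cref Cm).
Qed.

(** * Zero-dimensional sets and the inductive dimensions *)

Lemma frontier_openP (T : topologicalType) (W : set T) (x : T) : open W ->
  frontier W x <-> closure W x /\ ~ W x.
Proof.
by move=> oW; rewrite /frontier -(closure_id (~` W)).1//; exact: open_closedC.
Qed.

(** Zero-dimensionality of [F], expressed by open sets of the whole space so that they can be united
    for different [F]. *)
Definition frontier_base (T : topologicalType) (F : set T) : Prop :=
  forall x O, open O -> O x ->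
    exists W, [/\ open W, W x, closure W `<=` O & frontier W `&` F = set0].

(** Normality separates [G] from the union of [G'] with the complement of [O]. The frontier of [W]
    avoids [G], which is inside [W], and [G'], which is inside the other open set. *)
Lemma separating_open (R : realType) (X : metricType R) (G G' O F : set X) :
  closed G -> closed G' -> G `&` G' = set0 -> open O -> G `<=` O ->
  F `<=` G `|` G' ->
  exists W, [/\ open W, G `<=` W, closure W `<=` O & frontier W `&` F = set0].
Proof.
move=> cG cG' GG' oO GO FG.
have /(@normal_openP R)/(_ G (~` O `|` G') cG) : normal_space X.
  exact: pseudometric_normal.
case.
- by apply: closedU => //; exact: open_closedC.
- apply/seteqP; split=> // x [Gx [nOx|G'x]]; first exact: nOx (GO _ Gx).
  by rewrite -GG'.
move=> W [V [oW oV GW OV WV]].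
have clW : closure W `<=` ~` V.
  rewrite [X in _ `<=` X](closure_id _).1; last exact: open_closedC.
  by apply: closureS => x Wx Vx; have : (W `&` V) x by []; rewrite WV.
exists W; split=> //.
- by move=> x /clW nVx; apply: contrapT => nOx; apply/nVx/OV; left.
- apply/seteqP; split=> // x [/(frontier_openP _ oW)[/clW nVx nWx] /FG[Gx|G'x]].
    exact/nWx/GW.
  by apply/nVx/OV; right.
Qed.

Lemma closed_singleton (R : realType) (X : metricType R) (x : X) :
  closed [set x].
Proof.
by apply: accessible_closed_set1; exact/hausdorff_accessible/metric_hausdorff.
Qed.

Lemma closed_image_set_val (T : topologicalType) (F : set T)
    (A : set (set_type F)) :
  closed F -> closed A -> closed (set_val @` A).
Proof.
move=> cF /closed_openC[B oB BA].
have -> : set_val @` A = F `&` ~` B.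
  apply/seteqP; split=> [_ [x Ax <-]|x [Fx nBx]].
    split; first exact: set_valP.
    by move=> Bx; have : (~` A) x by rewrite -BA.
  exists (exist _ x (mem_set Fx)) => //.
  apply: contrapT => nAx; apply: nBx.
  have : (~` A) (exist _ x (mem_set Fx)) by [].
  by rewrite -BA.
by apply: closedI => //; exact: open_closedC.
Qed.

(** A set with empty frontier in [F] is clopen there; it and its complement in [F] are closed in
    [X], and [separating_open] applies. *)
Lemma frontier_base_of_ind_lt (R : realType) (X : metricType R) (F : set X) :
  closed F -> ind_lt 1 (set_type F) -> frontier_base F.
Proof.
move=> cF indF x O oO Ox.
have [Fx|nFx] := pselect (F x); last first.
  have [||||||W [oW xW WO WF]] :=
    @separating_open R X [set x] F O F; rewrite ?set1I ?memNset//.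
  - exact: closed_singleton.
  - by move=> _ ->.
  by exists W; split=> //; exact: xW.
pose xF : set_type F := exist _ x (mem_set Fx).
have [||V [oV Vx VO noV]] := indF xF (set_val @^-1` O) => //.
  by exists O.
have nV y : ~ frontier V y.
  by move=> fy; apply: noV; constructor; exists y; exact: mem_set.
have cV : closed V.
  move=> y Vy; apply: contrapT => nVy; apply: (nV y); split=> //.
  exact: subset_closure.
have [||||||W [oW xW WO WF]] :=
  @separating_open R X (set_val @` V) (set_val @` (~` V)) O F => //.
- exact: closed_image_set_val.
- by apply: closed_image_set_val => //; exact: open_closedC.
- apply/seteqP; split=> // _ [[y Vy <-] [z nVz /val_inj zy]].
  by apply: nVz; rewrite zy.
- by move=> _ [y /VO Oy <-].
- move=> y Fy; pose yF : set_type F := exist _ y (mem_set Fy).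
  by have [Vy|nVy] := pselect (V yF); [left|right]; exists yF.
by exists W; split=> //; apply: xW; exists xF.
Qed.

Lemma ind_lt_of_Ind_lt1 (T : topologicalType) :
  (forall x : T, closed [set x]) ->
  Ind_lt 1 T -> ind_lt 1 T.
Proof.
move=> cT IndT x U oU Ux.
have [|V [oV xV VU iV]] := IndT [set x] U (cT x) oU; first by move=> _ ->.
by exists V; split=> //; exact: xV.
Qed.

Definition small_frontiers (T : topologicalType) : Prop :=
  forall (x : T) U, open U -> U x ->
    exists V, [/\ open V, V x, V `<=` U & frontier_base (frontier V)].

Lemma closed_frontier (T : topologicalType) (A : set T) : closed (frontier A).
Proof. by apply: closedI; exact: closed_closure. Qed.

Lemma small_frontiers_of_ind_lt (R : realType) (X : metricType R) :
  ind_lt 2 X -> small_frontiers X.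
Proof.
move=> indX x U oU Ux; have [V [oV Vx VU iV]] := indX x U oU Ux.
exists V; split=> //; apply: frontier_base_of_ind_lt iV.
exact: closed_frontier.
Qed.

Lemma small_frontiers_of_Ind_lt (R : realType) (X : metricType R) :
  Ind_lt 2 X -> small_frontiers X.
Proof.
move=> IndX x U oU Ux.
have [|V [oV xV VU iV]] := IndX [set x] U (@closed_singleton R X x) oU.
  by move=> _ ->.
exists V; split=> //; first exact: xV.
apply: frontier_base_of_ind_lt; first exact: closed_frontier.
apply: ind_lt_of_Ind_lt1 iV => y.
have -> : [set y] = set_val @^-1` [set set_val y].
  by apply/seteqP; split=> [z ->|z /val_inj].
apply: closed_comp; last exact: closed_singleton.
by move=> z _; exact: initial_continuous.
Qed.

(** Lists of points of [K], directed by inclusion, generate a filter, and near-covering compactness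
    yields one list good for all of [K]. *)
Lemma compact_seq_cover (T : topologicalType) (K : set T) (V : T -> set T) :
  compact K -> (forall x, K x -> open (V x) /\ V x x) ->
  exists s : seq T, (forall x, x \in s -> K x) /\
    (forall y, K y -> exists2 x, x \in s & V x y).
Proof.
move=> /compact_near_coveringP cK KV.
pose D (s : seq T) := forall x, x \in s -> K x.
pose above (s t : seq T) := D t /\ {subset s <= t}.
have FF : Filter (filter_from D above).
  apply: filter_from_filter; first by exists [::].
  move=> s t Ds Dt; exists (s ++ t).
    by move=> x; rewrite mem_cat => /orP[/Ds|/Dt].
  by move=> r [Dr str]; split; split=> // x xs; apply: str;
    rewrite mem_cat xs ?orbT.
have [x Kx|s Ds hs] :=
    cK _ _ (fun (t : seq T) y => exists2 x, x \in t & V x y) FF.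
  have [oV Vx] := KV x Kx; exists (V x, above [:: x]); last first.
    by move=> [y t] /= [Vy [_ xt]]; exists x => //; apply: xt; exact: mem_head.
  split; first exact: open_nbhs_nbhs.
  by exists [:: x] => // y; rewrite inE => /eqP->.
by exists s; split=> //; apply: (hs s); split.
Qed.

Lemma frontierU_sub (T : topologicalType) (A B : set T) :
  open A -> open B -> forall x, frontier (A `|` B) x ->
  (frontier A x \/ frontier B x) /\ ~ A x /\ ~ B x.
Proof.
move=> oA oB x /(frontier_openP _ (openU oA oB))[].
rewrite closureU => -[cx|cx] /not_orP[nA nB]; split=> //.
  by left; apply/frontier_openP.
by right; apply/frontier_openP.
Qed.

Lemma frontier_base_compact (R : realType) (X : metricType R) (F K O : set X) :
  frontier_base F -> compact K -> open O -> K `<=` O ->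
  exists W, [/\ open W, K `<=` W, closure W `<=` O & frontier W `&` F = set0].
Proof.
move=> bF cK oO KO.
have /choice[V VP] : forall x, exists V, K x ->
    [/\ open V, V x, closure V `<=` O & frontier V `&` F = set0].
  move=> x; have [Kx|nKx] := pselect (K x); last by exists set0.
  by have [V VP] := bF x O oO (KO x Kx); exists V.
have [|s [sK Ks]] := compact_seq_cover cK (V := V).
  by move=> x /VP[].
suff [W [oW sW WO WF]] : exists W, [/\ open W,
    forall x, x \in s -> V x `<=` W, closure W `<=` O &
    frontier W `&` F = set0].
  by exists W; split=> // y /Ks[x xs Vxy]; exact: sW xs _ Vxy.
elim: s sK {Ks} => [|x s IH] sK.
  exists set0; rewrite /frontier closure0 !set0I; split=> //; exact: open0.
have [y ys|W [oW sW WO WF]] := IH; first by apply: sK; rewrite inE ys orbT.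
have [oV _ VO VF] := VP x (sK x (mem_head _ _)).
exists (V x `|` W); split; first exact: openU.
- by move=> y; rewrite inE => /orP[/eqP->|/sW Wy] z Vz; [left|right; exact: Wy].
- by rewrite closureU => z [/VO|/WO].
- apply/seteqP; split=> // z [/(frontierU_sub oV oW)[[fz|fz] _] Fz].
    by rewrite -VF.
  by rewrite -WF.
Qed.

(** The sum theorem in dimension zero: the frontier of [W] avoids [F], and its part in [G] is
    absorbed into a set [V] whose closure avoids [F] and whose frontier avoids [G]. *)
Lemma frontier_baseU (R : realType) (X : metricType R) (F G : set X) :
  closed F -> compact G -> frontier_base F -> frontier_base G ->
  frontier_base (F `|` G).
Proof.
move=> cF cG bF bG x O oO Ox.
have [W [oW Wx WO WF]] := bF x O oO Ox.
have cK : compact (frontier W `&` G).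
  by rewrite setIC; apply: compact_closedI => //; exact: closed_frontier.
have oOF : open (O `&` ~` F) by apply: openI => //; exact: closed_openC.
have [y [fy Gy]|V [oV KV VO VG]] := frontier_base_compact bG cK oOF.
  split; first by case/(frontier_openP _ oW): fy => /WO.
  by move=> Fy; have : (frontier W `&` F) y by []; rewrite WF.
exists (W `|` V); split; first exact: openU.
- by left.
- by rewrite closureU => y [/WO|/VO[]].
apply/seteqP; split=> // y [/(frontierU_sub oW oV)[fy [nW nV]] [Fy|Gy]].
  case: fy => [fy|/(frontier_openP _ oV)[/VO[_ nFy] _]]; last exact: nFy.
  by rewrite -WF.
case: fy => fy; first exact/nV/KV.
by rewrite -VG.
Qed.

Lemma find_near_const (T : topologicalType) (I : eqType) (V : I -> set T)
    (s : seq I) (y : T) :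
  (forall i, i \in s -> open (V i) /\ ~ frontier (V i) y) ->
  \forall z \near y,
    find (fun i => `[<V i z>]) s = find (fun i => `[<V i y>]) s.
Proof.
elim: s => [|i s IH] hs; first exact: nearW.
have hs' j : j \in s -> open (V j) /\ ~ frontier (V j) y.
  by move=> js; apply: hs; rewrite inE js orbT.
have [oV nfV] := hs i (mem_head _ _).
suff : \forall z \near y, `[<V i z>] = `[<V i y>].
  by move=> ci; near=> z => /=; rewrite (near ci z)// (near (IH hs') z).
have [Vy|nVy] := pselect (V i y).
  have : nbhs y (V i) by apply: open_nbhs_nbhs.
  apply: filterS => z Vz; by rewrite !asboolT.
have : nbhs y (~` closure (V i)).
  apply: open_nbhs_nbhs; split; first exact/closed_openC/closed_closure.
  by move=> cy; apply: nfV; apply/frontier_openP.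
apply: filterS => z nVz; rewrite !asboolF// => Vz; apply: nVz.
exact: subset_closure.
Unshelve. all: by end_near. Qed.

(** As [x] is covered, the common index is not the out-of-range value [size s]. *)
Lemma find_eq_common (T : Type) (I : eqType) (V : I -> set T) (s : seq I) x y :
  (exists2 i, i \in s & V i x) ->
  find (fun i => `[<V i x>]) s = find (fun i => `[<V i y>]) s ->
  exists2 i, i \in s & V i x /\ V i y.
Proof.
move=> [i si Vx] fE.
have hx : has (fun i => `[<V i x>]) s.
  by apply/hasP; exists i => //; exact/asboolP.
have hy : has (fun i => `[<V i y>]) s by rewrite has_find -fE -has_find.
exists (nth i s (find (fun i => `[<V i x>]) s)).
  by rewrite mem_nth// -has_find.
split; first exact/asboolP/(nth_find i hx).
by rewrite fE; exact/asboolP/(nth_find i hy).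
Qed.

(** [Y] is split into a neighbourhood of the zero-dimensional compact set [B s] of frontier points
    and the rest. Each region has a colouring constant at small scale, and of three points two share
    a region. *)
Lemma thin_of_small_frontiers (R : realType) (X : metricType R) (Y : set X) :
  compact Y -> small_frontiers X -> thin Y.
Proof.
move=> cY sX e e0; have e20 : 0 < e / 2 by rewrite divr_gt0.
have clY : closed Y by apply: compact_closed => //; exact: metric_hausdorff.
have /choice[V VP] : forall x : X, exists V, [/\ open V, V x,
    V `<=` ball x (e / 2) & frontier_base (frontier V)].
  by move=> x; apply: sX; [exact: open_metric_ball|exact: ballxx].
have [|s [_ Ys]] := compact_seq_cover cY (V := V).
  by move=> x _; case: (VP x).
pose B (t : seq X) := [set y | Y y /\ exists2 x, x \in t & frontier (V x) y].
have [cB bB] : compact (B s) /\ frontier_base (B s).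
  elim: s {Ys} => [|x t [cB bB]].
    have -> : B [::] = set0 by apply/seteqP; split=> // y [_ []].
    split; first exact: compact0.
    move=> x O oO Ox.
    have [||||||W [oW xW WO WF]] :=
      @separating_open R X [set x] set0 O set0 => //.
    - exact: closed_singleton.
    - exact: closed0.
    - by rewrite setI0.
    - by move=> _ ->.
    by exists W; split=> //; exact: xW.
  have -> : B (x :: t) = (frontier (V x) `&` Y) `|` B t.
    apply/seteqP; split=> [y [Yy [z]]|y].
      by rewrite inE => /orP[/eqP->|zt] fy; [left|right; split=> //; exists z].
    case=> [[fy Yy]|[Yy [z zt fy]]]; split=> //.
      by exists x => //; exact: mem_head.
    by exists z => //; rewrite inE zt orbT.
  have cfY : compact (frontier (V x) `&` Y).
    by rewrite setIC; apply: compact_closedI => //; exact: closed_frontier.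
  split; first exact: compactU.
  apply: frontier_baseU => //.
    by apply: closedI => //; exact: closed_frontier.
  move=> y O oO Oy; have [_ _ _ bV] := VP x.
  have [W [oW Wy WO WF]] := bV y O oO Oy; exists W; split=> //.
  by rewrite setIA WF set0I.
have /choice[W WP] : forall x : X, exists W, [/\ open W, W x,
    W `<=` ball x (e / 2) & frontier W `&` B s = set0].
  move=> x; have [W [oW Wx WO WF]] :=
    bB x _ (open_metric_ball x (e / 2)) (ballxx x e20).
  by exists W; split=> //; apply: subset_trans WO; exact: subset_closure.
have [|s' [_ Bs']] := compact_seq_cover cB (V := W).
  by move=> x _; case: (WP x).
pose k1 z := find (fun x => `[<W x z>]) s'.
pose k0 z := find (fun x => `[<V x z>]) s.
have const_mono (k : X -> nat) (A A' : set X) : A `<=` A' ->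
    (forall z z', A' z -> A' z' -> k z = k z') ->
    forall z z', A z -> A z' -> k z = k z'.
  by move=> AA' kA' z z' /AA' Az /AA' Az'; exact: kA'.
have near_const (k : X -> nat) y : (\forall z \near y, k z = k y) ->
    exists2 r : R, 0 < r & forall z z', ball y r z -> ball y r z' -> k z = k z'.
  move=> /nbhs_ballP[r /= r0 yr]; exists r => // z z' yz yz'.
  by rewrite (yr _ yz) (yr _ yz').
have [|r1 r10 k1c] := lebesgue_number (@const_mono k1) cB.
  move=> b Bb; apply: near_const; apply: find_near_const => x xs'.
  have [oW _ _ WB] := WP x; split=> // fb.
  by have : (frontier (W x) `&` B s) b by []; rewrite WB.
(* With half the radius, points within [r1 / 2] of a point of [N] still lie in a ball where [k1] is
   constant. *)
pose N := \bigcup_(b in B s) ball b (r1 / 2).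
have r120 : 0 < r1 / 2 by rewrite divr_gt0.
have cZ : compact (Y `&` ~` N).
  apply: compact_closedI => //; apply: open_closedC.
  by apply: bigcup_open => b _; exact: open_metric_ball.
have [|r0 r00 k0c] := lebesgue_number (@const_mono k0) cZ.
  move=> y [Yy nNy]; apply: near_const; apply: find_near_const => x xs.
  have [oV _ _ _] := VP x; split=> // fy; apply: nNy; exists y.
    by split=> //; exists x.
  exact: ballxx.
pose k y := (`[<N y>], if `[<N y>] then k1 y else k0 y).
exists (bool * nat)%type, k, (Num.min (r1 / 2) r0).
rewrite lt_min r120 r00; split=> //; split.
- have close x y : Y x -> Y y -> `[<N x>] = `[<N y>] ->
      mdist x y < Num.min (r1 / 2) r0 -> k x = k y.
    move=> Yx Yy NE; rewrite lt_min => /andP[xy1 xy0]; rewrite /k -NE.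
    congr pair; case: asboolP => [[b Bb bx]|nNx].
      apply: (k1c b Bb); first by apply: le_ball bx; lra.
      by rewrite (splitr r1); apply: ball_triangle bx _; rewrite ballEmdist.
    by apply: (k0c x); [|exact: ballxx|rewrite ballEmdist].
  move=> x y z Yx Yy Yz xy yz xz.
  have [E|[E|E]] : `[<N x>] = `[<N y>] \/ `[<N y>] = `[<N z>] \/
      `[<N x>] = `[<N z>].
    by case: `[<N x>]; case: `[<N y>]; case: `[<N z>]; tauto.
  + by rewrite (close x y)// eqxx.
  + by rewrite (close y z)// eqxx orbT.
  + by rewrite (close x z)// eqxx !orbT.
move=> x y Yx Yy [<-]; case: asboolP => [[b Bb bx]|nNx] kE.
  (* The chosen sets [W] cover [B s] but perhaps not [x]; comparison with [b] shows that the index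
     of [x] is a genuine one. *)
  have kb : k1 b = k1 x.
    apply: (k1c b Bb); first exact: ballxx.
    by apply: le_ball bx; lra.
  have [w ws' [Wwb Wwx]] := find_eq_common (Bs' b Bb) kb.
  have [w' _ [Wx Wy]] := find_eq_common (ex_intro2 _ _ w ws' Wwx) kE.
  by have [_ _ Wb _] := WP w'; apply: (@mdist_ball_lt _ _ _ w'); exact: Wb.
have [w _ [Vx Vy]] := find_eq_common (Ys x Yx) kE.
by have [_ _ Vb _] := VP w; apply: (@mdist_ball_lt _ _ _ w); exact: Vb.
Qed.

Lemma thin_of_one_dimensional (R : realType) (X : metricType R) (Y : set X) :
  compact Y -> one_dimensional X -> thin Y.
Proof.
move=> cY [] [dimX _].
- exact: thin_of_small_frontiers cY (small_frontiers_of_ind_lt dimX).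
- exact: thin_of_small_frontiers cY (small_frontiers_of_Ind_lt dimX).
- exact: thin_of_cov_lt.
- exact: thin_of_ucov_lt.
Qed.

(** * Pushing a null-homotopy into the image of the path *)

Lemma nullhomotopic_in_image (R : realType) (X : metricType R) (u v : R)
    (c : R -> X) : one_dimensional X -> u < v ->
  {within `[u, v], continuous c} -> nullhomotopic_in setT u v c ->
  nullhomotopic_in (c @` `[u, v]) u v c.
Proof.
move=> dimX uv cc [x0 [H [cH _ Hh Hv]]].
have thinY : thin (H @` (`[u, v] `*` `[0, 1])).
  apply: thin_of_one_dimensional => //; apply: continuous_compact => //.
  by apply: compact_setX; exact: segment_compact.
have [L lamL] := lamination_of_coherent_pairings cc
  (fun e e0 => coherent_pairing_of_nullhomotopy uv cH thinY Hh Hv e0).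
exact: nullhomotopic_of_lamination uv cc lamL.
Qed.

Theorem theorem11 (R : realType) (X : metricType R) (a b : R) (c : R -> X)
    (Xdim1 : one_dimensional X) (cpath : is_path a b c) :
  normal_path a b c <-> weakly_normal_path a b c.
Proof.
have [_ cc] := cpath; split=> nc [u [v [au uv vb cuv [x0 [H hH]]]]]; apply: nc.
  exists u, v; split=> //; exists x0, H.
  by case: hH => cH _ Hh Hv; split.
exists u, v; split=> //; apply: nullhomotopic_in_image => //.
  apply: continuous_subspaceW cc => t; rewrite /= !in_itv /=.
  by move=> /andP[ut tv]; rewrite (le_trans au ut) (le_trans tv vb).
by exists x0, H.
Qed.
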